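(* There is a constant $c>0$ such that for every $n\ge1$ and every 3-presentation $\langle S\mid R\rangle\cong\mathbb{Z}^n$, we have $|S|\ge c\,n^{3/2}$.
   Context: A 3-presentation of a group $G$ is a group presentation $\langle S\mid R\rangle\cong G$ (with $S,R$ finite) in which each relation in $R$ is either the empty word, or $g^a$, or $g^ah^b$, or $g^ah^bi^c$, where $g,h,i\in S$ (not necessarily distinct) and $a,b,c\in\mathbb{Z}$. *)

(* Defs.v *)
From mathcomp Require Import all_boot all_order all_algebra.
Set Implicit Arguments. Unset Strict Implicit. Unset Printing Implicit Defensive.
Import GRing.Theory Num.Theory.

(* Generators S = 'I_k.  A letter is (s, b) meaning s if b = false, s^-1 if b = true.
   Words are elements of the free monoid on S ∪ S^-1. *)
Definition letter (k : nat) := ('I_k * bool)%type.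
Definition word (k : nat) := seq (letter k).
Definition inv_letter k (x : letter k) : letter k := (x.1, ~~ x.2).

(* A relation is a list of syllables g^a (g : S, a : int); a relation g^a h^b i^c
   is the list [:: (g,a); (h,b); (i,c)]. *)
Definition relator (k : nat) := seq ('I_k * int)%type.

Definition expand k (r : relator k) : word k :=
  flatten [seq nseq `|p.2|%N (p.1, (p.2 < 0)%R) | p <- r].

Definition three_presentation k (Rel : seq (relator k)) : bool :=
  all (fun r => size r <= 3) Rel.

Inductive wequiv k (Rel : seq (relator k)) : word k -> word k -> Prop :=
| we_refl w : wequiv Rel w w
| we_sym u v : wequiv Rel u v -> wequiv Rel v u
| we_trans u v w : wequiv Rel u v -> wequiv Rel v w -> wequiv Rel u w
| we_cancel u v x : wequiv Rel (u ++ [:: x; inv_letter x] ++ v) (u ++ v)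
| we_rel u v r : r \in Rel -> wequiv Rel (u ++ expand r ++ v) (u ++ v).

Definition eval_word k n (f : 'I_k -> 'rV[int]_n) (w : word k) : 'rV[int]_n :=
  (\sum_(x <- w) (if x.2 then - f x.1 else f x.1))%R.

(* <S | Rel> ≅ Z^n : there is a map S -> Z^n inducing an isomorphism from the
   presented group (words modulo wequiv) onto Z^n: surjective, and the kernel is
   exactly the class of the empty word (which also gives well-definedness). *)
Definition presents_Zn k (Rel : seq (relator k)) (n : nat) : Prop :=
  exists f : 'I_k -> 'rV[int]_n,
    (forall v : 'rV[int]_n, exists w : word k, eval_word f w = v) /\
    (forall w : word k, eval_word f w = 0%R <-> wequiv Rel w [::]).

(* Main.v *)
(** A relator [g^a h^b i^c] makes the images of [g, h, i] in Q^n satisfy a linear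
    relation with at most three terms, and it forces commutation only through one
    bivector of Q^n (the wedge of two of its syllables).  If these bivectors did
    not span all of the exterior square, a skew form [B] vanishing on them would
    give a homomorphism onto a nonabelian Heisenberg-type group; hence for n >= 2
    there are N >= n^2/8 relators with independent bivectors.  Independence implies that two
    generators occur together in at most one of these relators.  After passing to
    a subset of the generators with many relators and minimal degree of order N/k,
    the vectors of these generators have rank at least of order sqrt N, since the
    bivectors live in their exterior square, and at most of order k^2/N by the
    rank bound for design matrices.  With N >= n^2/8 this gives k^2 >= C n^3. *)

Require Import Defs.
From mathcomp Require Import all_boot all_order all_algebra.
From mathcomp Require Import zify ring lra.
Set Implicit Arguments.
Unset Strict Implicit.
Unset Printing Implicit Defensive.
Import Order.TTheory GRing.Theory Num.Theory.
Local Open Scope ring_scope.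

(** * Inequalities between sums and products *)

Lemma prod_1D_mul_1B (R : realDomainType) (I : finType) (y : I -> R) :
  (forall i, 0 <= y i) -> \prod_i (1 + y i) * (1 - \sum_i y i) <= 1.
Proof.
move=> y0.
have P0 (r : seq I) : 0 <= \prod_(i <- r) (1 + y i).
  by apply: prodr_ge0 => i _; rewrite addr_ge0.
have S0 (r : seq I) : 0 <= \sum_(i <- r) y i by apply: sumr_ge0.
elim: (index_enum I) => [|i r IH]; first by rewrite !big_nil subr0 mulr1.
rewrite !big_cons; apply: le_trans IH.
have := mulr_ge0 (P0 r) (mulr_ge0 (y0 i) (addr_ge0 (y0 i) (S0 r))).
by nra.
Qed.

Lemma bernoulli_1D (R : realDomainType) (x : R) (N : nat) :
  0 <= x -> 1 + N%:R * x <= (1 + x) ^+ N.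
Proof.
move=> x0; elim: N => [|N IH]; first by rewrite mul0r addr0 expr0.
rewrite exprS -natr1.
apply: le_trans (ler_wpM2l (addr_ge0 ler01 x0) IH).
have := mulr_ge0 (ler0n R N) (mulr_ge0 x0 x0); nra.
Qed.

(* Replaces [1 + x <= exp x], so that no exponential is needed. *)
Lemma sum_ge_of_prod_1D_ge (R : realFieldType) (I : finType) (x : I -> R)
    (d : nat) :
  (forall i, 0 <= x i) -> 4 ^+ d <= \prod_i (1 + x i) -> d%:R <= \sum_i x i.
Proof.
move=> x0; case: d => [_|d]; first exact: sumr_ge0.
(* If the sum is below [d.+1], the parts [y i = x i / N] have sum below 1/2, so the product of the
   [1 + y i] is below 2. By Bernoulli the product of the [1 + x i] is then below
   [2 ^+ N = 4 ^+ d.+1]. *)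
set N := (2 * d.+1)%N; move=> prod_ge; rewrite leNgt; apply/negP => sum_lt.
have N0 : (0 : R) < N%:R by rewrite ltr0n.
pose y i := x i / N%:R.
have y0 i : 0 <= y i by rewrite divr_ge0 // ltW.
have sumy : \sum_i y i < 1 / 2.
  rewrite -mulr_suml ltr_pdivrMr //; apply: (lt_le_trans sum_lt).
  by rewrite /N natrM mulrA; lra.
have prody : \prod_i (1 + y i) < 2.
  have := prod_1D_mul_1B y0.
  have : 0 <= \prod_i (1 + y i) by apply: prodr_ge0 => i _; rewrite addr_ge0.
  by nra.
have : \prod_i (1 + x i) <= (\prod_i (1 + y i)) ^+ N.
  rewrite -prodrXl; apply: ler_prod => i _; rewrite addr_ge0 //=.
  by have := bernoulli_1D N (y0 i); rewrite /y mulrC divfK ?gt_eqF.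
move/(le_trans prod_ge); rewrite leNgt /N exprM => /negP; apply.
have p0 : 0 <= \prod_i (1 + y i).
  by apply: prodr_ge0 => i _; rewrite addr_ge0.
rewrite ltrXn2r // ?exprn_ge0 //.
by rewrite expr2; nra.
Qed.

(** * Column scaling of sparse matrices *)

(** A [t] with an entry above [B] has a larger value than the zero function, so a minimum over the
    finitely many [t] bounded by [B] is global. *)
Lemma coercive_nat_min (R : realDomainType) (k B : nat)
    (f : {ffun 'I_k -> nat} -> R) :
  (forall t, f t <= f [ffun=> 0%N] -> (\sum_i t i <= B)%N) ->
  exists t0, forall t, f t0 <= f t.
Proof.
move=> coer.
pose emb (t : {ffun 'I_k -> 'I_B.+1}) : {ffun 'I_k -> nat} := [ffun i => t i : nat].
have [t _ tmin] := @arg_minP _ _ _ [ffun=> ord0] predT (f \o emb) isT.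
have t_le0 : f (emb t) <= f [ffun=> 0%N].
  apply: le_trans (tmin [ffun=> ord0] isT) _ => /=.
  have -> : emb [ffun=> ord0] = [ffun=> 0%N]; last exact: lexx.
  by apply/ffunP => i; rewrite /emb !ffunE.
exists (emb t) => s; case: (leP (f s) (f [ffun=> 0%N])) => [/coer sB|/ltW].
  have sE i : (s i < B.+1)%N.
    by rewrite ltnS; apply: leq_trans sB; rewrite (bigD1 i) //= leq_addr.
  have <- : emb [ffun i => Ordinal (sE i)] = s; last exact: tmin.
  by apply/ffunP => i; rewrite /emb !ffunE.
exact: le_trans t_le0.
Qed.

Lemma nonzero_sqr_lower_bound (R : realFieldType) (m k : nat) (M : 'M[R]_(m, k)) :
  exists c : R, [/\ 0 < c, c <= 1 & forall j g, M j g != 0 -> c <= M j g ^+ 2].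
Proof.
pose mn (x : R) := Num.min 1 (x ^+ 2).
have mn01 (p : 'I_m * 'I_k) : M p.1 p.2 != 0 -> 0 < mn (M p.1 p.2) <= 1.
  by move=> nz; rewrite /mn lt_min ltr01 exprn_even_gt0 /= ?nz ?ge_min ?lexx.
(* Every factor lies in (0, 1], so the product is at most each of them. *)
exists (\prod_(p | M p.1 p.2 != 0) mn (M p.1 p.2)); split.
- by apply: prodr_gt0 => p /mn01 /andP[].
- by apply: prodr_ile1 => p /mn01 /andP[/ltW -> ->].
move=> j g nz; rewrite (bigD1 (j, g)) //=.
have /andP[p0 _] := mn01 (j, g) nz.
apply: le_trans (_ : mn (M j g) <= _); last by rewrite ge_min lexx orbT.
rewrite ler_piMr ?(ltW p0) //.
by apply: prodr_ile1 => p /andP[/mn01 /andP[/ltW -> ->]].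
Qed.

(* Discrete matrix scaling with [w g = 2 ^ t g]: take [t] minimizing the ratio of
   the product of the squared row norms to [4 ^ (d * sum t)].  The ratio is coercive
   because each row has at most 3 entries and each column more than [3 * d], and
   minimality against incrementing [t g] bounds the sum of column [g]. *)
Lemma column_scaling (R : archiRealFieldType) (m k d : nat) (M : 'M[R]_(m, k)) :
  (forall j, 0 < #|[set g | M j g != 0%R]| <= 3)%N ->
  (forall g, 3 * d < #|[set j | M j g != 0%R]|)%N ->
  exists w : 'I_k -> R, (forall g, 0 < w g) /\
    forall g, d%:R <=
      3 * \sum_j (M j g * w g) ^+ 2 / (\sum_h (M j h * w h) ^+ 2).
Proof.
move=> row_supp col_supp.
pose Q (t : {ffun 'I_k -> nat}) j := \sum_h M j h ^+ 2 * 4 ^+ t h.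
pose f (t : {ffun 'I_k -> nat}) := \prod_j Q t j / 4 ^+ (d * \sum_g t g).
have p4 n : (0 : R) < 4 ^+ n by rewrite exprn_gt0.
have [c [c0 c1 cM]] := nonzero_sqr_lower_bound M.
have Qge (t : {ffun 'I_k -> nat}) j g : M j g != 0 -> 4 ^+ t g <= Q t j / c.
  move=> /cM cMg; rewrite ler_pdivlMr // mulrC /Q (bigD1 g) //=.
  rewrite ler_wpDr ?ler_wpM2r ?(ltW (p4 _)) //.
  by apply: sumr_ge0 => h _; rewrite mulr_ge0 ?sqr_ge0 ?(ltW (p4 _)).
have nz j : exists g, M j g != 0.
  have /andP[/card_gt0P[g]] := row_supp j.
  by rewrite inE; exists g.
have Qc1 t j : 1 <= Q t j / c.
  have [g /(Qge t)] := nz j; apply: le_trans.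
  by rewrite exprn_ege1 // ler1n.
have Q0 t j : 0 < Q t j.
  have := Qc1 t j; rewrite ler_pdivlMr // mul1r; exact: lt_le_trans.
have f0 t : 0 < f t.
  by rewrite divr_gt0 // prodr_gt0.
(* Coercivity by double counting: row [j] carries at most three factors [4 ^+ t g], each at most
   [Q t j / c], while column [g] occurs at least [3 * d + 1] times. The denominator of [f t ^+ 3]
   absorbs [3 * d] occurrences and one remains. *)
have lower (t : {ffun 'I_k -> nat}) : 4 ^+ (\sum_g t g) <= f t ^+ 3 / c ^+ (m * 3).
  have : \prod_j \prod_(g | M j g != 0) 4 ^+ t g <= \prod_j (Q t j / c) ^+ 3.
    apply: ler_prod => j _; rewrite prodr_ge0 => [|g _]; last exact: ltW.
    have /andP[_] := row_supp j.
    move/(ler_weXn2l (Qc1 t j)); apply: le_trans.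
    rewrite -prodr_const [leRHS](eq_bigl (fun g => M j g != 0)); last first.
      by move=> g; rewrite inE.
    by apply: ler_prod => g /(Qge t) ->; rewrite ltW.
  rewrite (exchange_big_dep predT) //=.
  have -> : \prod_j (Q t j / c) ^+ 3 =
      f t ^+ 3 / c ^+ (m * 3) * 4 ^+ (3 * d * \sum_g t g).
    rewrite prodrXl big_split /= prodr_const card_ord exprMn -exprM exprVn.
    rewrite -mulnA (mulnC 3%N (d * _)%N) (exprM _ (d * _) 3) /f expr_div_n [RHS]mulrAC divfK //.
    by rewrite expf_neq0 // gt_eqF.
  rewrite -ler_pdivrMr //; apply: le_trans; rewrite ler_pdivlMr // -exprD.
  rewrite -mulSn big_distrr /= -prodrXr.
  apply: ler_prod => g _; rewrite ltW //= prodr_const.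
  rewrite -exprM mulnC ler_weXn2l ?ler1n // leq_mul //.
  by rewrite (leq_trans (col_supp g)) // subset_leq_card //; apply/subsetP => j; rewrite !inE.
set t00 : {ffun 'I_k -> nat} := [ffun=> 0%N].
have cm0 : 0 < c ^+ (m * 3) by rewrite exprn_gt0.
have [t tmin] : exists t0, forall t, f t0 <= f t.
  apply: (@coercive_nat_min _ _ (Num.bound (f t00 ^+ 3 / c ^+ (m * 3)))) => t ft.
  have /archi_boundP : 0 <= f t00 ^+ 3 / c ^+ (m * 3).
    by rewrite divr_ge0 ?exprn_ge0 ?(ltW (f0 _)) ?(ltW c0).
  set B := Num.bound _ => ltB.
  rewrite -(ler_nat R) ltW //; apply: le_lt_trans ltB.
  apply: le_trans (_ : 4 ^+ (\sum_g t g) <= _).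
    by rewrite -natrX ler_nat ltnW // ltn_expl.
  apply: le_trans (lower t) _; rewrite ler_pM2r ?invr_gt0 //.
  by rewrite lerXn2r // nnegrE ltW.
exists (fun g => 2 ^+ t g); split=> [g|g]; first by rewrite exprn_gt0.
have sq2 j h : (M j h * 2 ^+ t h) ^+ 2 = M j h ^+ 2 * 4 ^+ t h.
  by rewrite (_ : 4 = 2 ^+ 2 :> R) -?exprM ?exprMn -?exprM ?(mulnC 2) //; ring.
rewrite mulr_sumr; apply: sum_ge_of_prod_1D_ge => [j|].
  rewrite mulr_ge0 // divr_ge0 ?sqr_ge0 // sumr_ge0 // => h _.
  exact: sqr_ge0.
(* Incrementing [t g] multiplies the denominator of [f] by [4 ^+ d] and [Q t j] by 1 plus 3 times
   the share of [g] in row [j], as 4 - 1 = 3. *)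
pose t' : {ffun 'I_k -> nat} := [ffun h => (t h + (h == g))%N].
have := tmin t'; rewrite /f.
have -> : (\sum_h t' h = \sum_h t h + 1)%N.
  under eq_bigr do rewrite ffunE.
  rewrite big_split /=; congr addn.
  by rewrite (bigD1 g) //= eqxx big1 // => h /negPf ->.
have QE j : Q t' j = Q t j * (1 + 3 * ((M j g * 2 ^+ t g) ^+ 2 /
    \sum_h (M j h * 2 ^+ t h) ^+ 2)).
  under eq_bigr do rewrite sq2.
  rewrite sq2 -/(Q t j) mulrDr mulr1 mulrCA [Q t j * _]mulrC divfK ?gt_eqF //.
  rewrite /Q (bigD1 g) //= [in RHS](bigD1 g) //= ffunE eqxx addn1 (exprS 4).
  rewrite (eq_bigr (fun h => M j h ^+ 2 * 4 ^+ t h)).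
    by ring.
  by move=> h /negPf ne; rewrite ffunE ne addn0.
under [X in _ <= X / _]eq_bigr do rewrite QE.
rewrite big_split /= mulnDr muln1 exprD invfM mulrACA.
by rewrite ler_pMr ?f0 // ler_pdivlMr // mul1r.
Qed.

(** * The rank bound for design matrices *)

Lemma mxtrace_mul_tr (R : pzRingType) (m n : nat) (A B : 'M[R]_(m, n)) :
  \tr (A *m B^T) = \sum_i \sum_j A i j * B i j.
Proof.
by apply: eq_bigr => i _; rewrite mxE; apply: eq_bigr => j _; rewrite mxE.
Qed.

Lemma mulmx_tr_eq0 (R : realDomainType) (n : nat) (x : 'rV[R]_n) :
  x *m x^T = 0 -> x = 0.
Proof.
move=> /(congr1 mxtrace); rewrite mxtrace_mul_tr mxtrace0 big_ord1 => /eqP.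
rewrite psumr_eq0 => [/allP x0|j _]; last by rewrite -expr2 sqr_ge0.
apply/rowP => j; have := x0 j (mem_index_enum j).
by rewrite mulf_eq0 orbb mxE => /eqP.
Qed.

(* [P] is the orthogonal projection onto the column space of [U], so [rank U]
   is its squared Frobenius norm, and [E = P + (E - P)] is orthogonal. *)
Lemma rank_le_frobenius (R : realFieldType) (k n : nat) (E : 'M[R]_k)
    (U : 'M[R]_(k, n)) :
  E *m U = U -> (\rank U)%:R <= \sum_i \sum_j E i j ^+ 2.
Proof.
move=> EU; pose Y := col_base U.
have EY : E *m Y = Y.
  apply: (row_free_inj (row_base_free U)).
  by rewrite -mulmxA !mulmx_base.
have Yfree : row_free Y^T.
  by rewrite /row_free mxrank_tr; apply: col_base_full.
clearbody Y.
pose G := Y^T *m Y.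
have Gunit : G \in unitmx.
  rewrite -row_free_unit; apply: inj_row_free => v vG.
  have /mulmx_tr_eq0 : (v *m Y^T) *m (v *m Y^T)^T = 0.
    by rewrite trmx_mul trmxK mulmxA -(mulmxA v) vG mul0mx.
  by rewrite -[RHS](mul0mx _ Y^T) => /(row_free_inj Yfree).
pose P := Y *m invmx G *m Y^T.
have PT : P^T = P.
  by rewrite /P 2!trmx_mul trmxK trmx_inv /G trmx_mul trmxK mulmxA.
have PP : P *m P = P.
  by rewrite /P !mulmxA -(mulmxA _ Y^T Y) -/G mulmxKV.
have EP : E *m P = P by rewrite /P !mulmxA EY.
have trP : \tr P = (\rank U)%:R.
  by rewrite mxtrace_mulC mulmxA mulmxV // mxtrace1.
have : 0 <= \tr ((E - P) *m (E - P)^T).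
  by rewrite mxtrace_mul_tr; do 2![apply: sumr_ge0 => ? _]; rewrite -expr2 sqr_ge0.
have -> : (E - P) *m (E - P)^T = E *m E^T - P.
  have PE : P *m E^T = P by rewrite -{1}PT -trmx_mul EP PT.
  rewrite linearB /= mulmxBl !mulmxBr PT EP PP PE.
  by rewrite subrr subr0.
by rewrite linearB /= trP mxtrace_mul_tr subr_ge0.
Qed.

(** There are no cross terms. In [design_rank] this is where the condition on overlaps of columns
    enters. *)
Lemma sqr_sum_unique (R : comPzRingType) (I : finType) (x : I -> R) :
  (forall i j, x i != 0 -> x j != 0 -> i = j) ->
  (\sum_i x i) ^+ 2 = \sum_i x i ^+ 2.
Proof.
move=> xu; case: (pickP (fun i => x i != 0)) => [i xi|x0]; last first.
  have z i : x i = 0 by apply/eqP; rewrite -[_ == _]negbK x0.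
  by rewrite !big1 ?expr0n // => i _; rewrite z expr0n.
have z j : j != i -> x j = 0.
  by move=> ji; apply/eqP; apply: contraNT ji => /xu /(_ xi) ->.
rewrite (bigD1 i) //= [in RHS](bigD1 i) //= !big1 ?addr0 // => j /z -> //.
by rewrite expr0n.
Qed.

(* The rank bound for design matrices of Barak, Dvir, Wigderson and Yehudayoff:
   after [column_scaling], each row of [U] is a combination with small
   coefficients of other rows, one for each row of [M] in which it occurs. *)
Lemma design_rank (R : archiRealFieldType) (m k n d : nat) (M : 'M[R]_(m, k))
    (U : 'M[R]_(k, n)) :
  (forall j, 0 < #|[set g | M j g != 0%R]| <= 3)%N ->
  (forall g, 3 * d < #|[set j | M j g != 0%R]|)%N ->
  (forall g h i j, g != h -> M i g != 0 -> M i h != 0 ->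
     M j g != 0 -> M j h != 0 -> i = j) ->
  M *m U = 0 -> (d * \rank U <= 3 * k)%N.
Proof.
move=> row_supp col_supp overlap MU0.
have [w [w0 wC]] := column_scaling row_supp col_supp.
case: d {col_supp} wC => [|d wC]; first by rewrite mul0n.
pose a j g := M j g * w g.
pose q j := \sum_h a j h ^+ 2.
pose C g := \sum_j a j g ^+ 2 / q j.
have C0 g : 0 < C g.
  by have := wC g; rewrite -/(C g); have := ltr0Sn R d; nra.
(* [S] annihilates the rescaled matrix [U'], so [E] fixes it. Dividing by [C g = S g g] makes the
   diagonal of [E] zero. *)
pose S g h := \sum_j a j g * a j h / q j.
pose E := \matrix_(g, h) ((g == h)%:R - S g h / C g).
pose U' := diag_mx (\row_g (w g)^-1) *m U.
have U'E g i : U' g i = U g i / w g.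
  by rewrite /U' mul_diag_mx !mxE mulrC.
have aU' j i : \sum_h a j h * U' h i = 0.
  have /matrixP /(_ j i) := MU0; rewrite !mxE => {2}<-.
  by apply: eq_bigr => h _; rewrite U'E /a mulrACA divff ?mulr1 ?gt_eqF.
have EU' : E *m U' = U'.
  apply/matrixP => g i; rewrite mxE.
  under eq_bigr do rewrite mxE mulrBl.
  rewrite sumrB (bigD1 g) //= eqxx mul1r big1 ?addr0 => [|h]; last first.
    by rewrite eq_sym => /negPf ->; rewrite mul0r.
  apply/eqP; rewrite subr_eq addrC -subr_eq subrr eq_sym; apply/eqP.
  under eq_bigr => h _.
    rewrite (_ : _ * _ = (C g)^-1 * \sum_j (a j g / q j) * (a j h * U' h i)).
    over.
    rewrite mulrAC mulrC /S mulr_suml; congr (_ * _).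
    by apply: eq_bigr => j _; ring.
  rewrite -mulr_sumr exchange_big /= big1 ?mulr0 // => j _.
  by rewrite -mulr_sumr aU' mulr0.
have rankU : \rank U' = \rank U.
  rewrite eqmxMfull // row_full_unit unitmxE det_diag unitfE.
  by apply/prodf_neq0 => g _; rewrite mxE invr_neq0 // gt_eqF.
have := rank_le_frobenius EU'; rewrite rankU => rank_le.
(* Since two columns meet in at most one row, [S g h ^+ 2] is a sum of squares over [j]. Summing
   first over [h], with [a j h ^+ 2] adding up to at most [q j], leaves [(C g)^-2 * C g]. *)
have Erow g : \sum_h E g h ^+ 2 <= (C g)^-1.
  rewrite (bigD1 g) //= mxE eqxx.
  have -> : S g g = C g by apply: eq_bigr => j _; rewrite expr2.
  rewrite divff ?gt_eqF // subrr expr0n add0r.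
  apply: le_trans (_ : (C g)^-2 * C g <= _); last first.
    by rewrite expr2 invfM mulfVK ?gt_eqF.
  rewrite {2}/C mulr_sumr.
  apply: le_trans (_ : \sum_(h | h != g) (C g)^-2 *
      \sum_j a j g ^+ 2 / q j ^+ 2 * a j h ^+ 2 <= _).
    apply: ler_sum => h hg; rewrite mxE eq_sym (negPf hg) sub0r sqrrN expr_div_n mulrC.
    have -> : S g h ^+ 2 = \sum_j (a j g * a j h / q j) ^+ 2.
      apply: sqr_sum_unique.
      move=> i j; rewrite /a !mulf_eq0 !negb_or.
      move=> /andP[/andP[/andP[ig _] /andP[ih _]] _].
      move=> /andP[/andP[/andP[jg _] /andP[jh _]] _].
      by apply: overlap ig ih jg jh; rewrite eq_sym.
    rewrite ler_wpM2l ?invr_ge0 ?sqr_ge0 //; apply: ler_sum => j _.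
    by rewrite expr_div_n exprMn mulrAC.
  rewrite -mulr_sumr exchange_big /= mulr_sumr; apply: ler_sum => j _.
  rewrite ler_wpM2l ?invr_ge0 ?sqr_ge0 // -mulr_sumr.
  have q_ge0 : 0 <= q j by apply: sumr_ge0 => h _; apply: sqr_ge0.
  apply: le_trans (_ : a j g ^+ 2 / q j ^+ 2 * q j <= _).
    rewrite ler_wpM2l ?divr_ge0 ?sqr_ge0 //.
    by rewrite [leRHS](bigD1 g) //= lerDr sqr_ge0.
  (* As [0^-1 = 0], both sides vanish when [q j = 0]. *)
  have [->|qn0] := eqVneq (q j) 0; first by rewrite mulr0 invr0 mulr0.
  by rewrite expr2 invfM mulrA divfK.
have : (d.+1 * \rank U)%:R <= (3 * k)%:R :> R.
  have dR : (0 : R) < d.+1%:R by rewrite ltr0n.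
  rewrite natrM mulrC -ler_pdivlMr //; apply: le_trans rank_le _.
  apply: le_trans (ler_sum _ (fun g _ => Erow g)) _.
  apply: le_trans (_ : \sum_(g < k) 3 / d.+1%:R <= _).
    apply: ler_sum => g _; rewrite -[leLHS]mul1r ler_pdivrMr // mulrAC.
    by rewrite ler_pdivlMr // mul1r; apply: wC.
  by rewrite sumr_const card_ord natrM -(mulr_natr (3 / _) k) [leLHS]mulrAC.
by rewrite ler_nat.
Qed.

(** * Sparse linear relations with independent bivectors *)

(** The bivector of [x] and [y], encoded as a skew matrix so that linear maps act on it by
    congruence. *)
Definition wedge (R : pzRingType) (n : nat) (x y : 'rV[R]_n) : 'M[R]_n :=
  x^T *m y - y^T *m x.

Lemma wedge_mulmx (R : comPzRingType) (p n : nat) (x y : 'rV[R]_p) (A : 'M[R]_(p, n)) :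
  wedge (x *m A) (y *m A) = A^T *m wedge x y *m A.
Proof. by rewrite /wedge !trmx_mul mulmxBr mulmxBl !mulmxA. Qed.

(** For a rank factorization [A = C *m B], the row is a linear function of [C^T *m X *m C], a square
    matrix of size [\rank A]. *)
Lemma rank_congruences (F : fieldType) (m p n : nat) (A : 'M[F]_(p, n))
    (W : 'M[F]_(m, n * n)) :
  (forall j, exists X, row j W = mxvec (A^T *m X *m A)) ->
  (\rank W <= \rank A * \rank A)%N.
Proof.
move=> WA; pose B := row_base A.
pose L : 'M[F]_(\rank A) -> 'M[F]_n := mulmxr B \o mulmx B^T.
apply: leq_trans (rank_leq_row (lin_mx L)); apply: mxrankS.
apply/row_subP => j; have [X ->] := WA j.
rewrite -[X in mxvec (X^T *m _ *m X)]mulmx_base trmx_mul.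
rewrite (_ : mxvec _ = mxvec ((col_base A)^T *m X *m col_base A) *m lin_mx L) ?submxMl //.
by rewrite mul_vec_lin /L /= /B !mulmxA.
Qed.

Lemma card_set_enum_val (T : finType) (A : {set T}) (P : pred T) :
  #|[set i : 'I_#|A| | P (enum_val i)]| = #|[set x in A | P x]|.
Proof.
rewrite -(card_imset _ enum_val_inj); apply: eq_card => x.
rewrite inE; apply/imsetP/andP => [[i]|[xA Px]].
  by rewrite inE => Pi ->; rewrite enum_valP.
by exists (enum_rank_in xA x); rewrite ?inE enum_rankK_in.
Qed.

(* Maximizing [#|J H| + d * #|~: H|]: deleting a point of degree less than [d]
   from [H] would increase it. *)
Lemma min_degree_subset (J I : finType) (S : J -> {set I}) (d : nat) :
  exists H : {set I}, let JH := [set j | S j \subset H] in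
    (#|J| <= #|JH| + d * #|I|)%N /\
    forall g, g \in H -> (d <= #|[set j in JH | g \in S j]|)%N.
Proof.
pose f (H : {set I}) := (#|[set j | S j \subset H]| + d * #|~: H|)%N.
have [H _ Hmax] := @arg_maxnP _ [set: I] predT f isT.
exists H; split.
  have := Hmax [set: I] isT; rewrite /f /= setCT cards0 muln0 addn0 => le.
  apply: leq_trans (leq_trans _ le) _; last by rewrite leq_add2l leq_mul2l max_card orbT.
  by rewrite -cardsT subset_leq_card //; apply/subsetP => j _; rewrite inE subsetT.
move=> g gH; have := Hmax (H :\ g) isT; rewrite /f /=.
have := cardsC H; have := cardsC (H :\ g); have := cardsD1 g H; rewrite gH => e1 e2 e3.
have : (#|[set j | S j \subset H]| <=
    #|[set j | S j \subset H :\ g]| + #|[set j in [set j | S j \subset H] | g \in S j]|)%N.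
  apply: leq_trans (leq_card_setU _ _); apply: subset_leq_card.
  apply/subsetP => j; rewrite !inE => SH; rewrite SH /= orbC.
  case: (boolP (g \in S j)) => //= gS; apply/subsetP => h hS.
  rewrite !inE (subsetP SH) // andbT; apply: contraNneq gS => <- //.
have -> : #|~: (H :\ g)| = #|~: H|.+1 by lia.
by rewrite mulnS; lia.
Qed.

Lemma row_free_rowsub (F : fieldType) (p m n : nat) (f : 'I_p -> 'I_m)
    (W : 'M[F]_(m, n)) :
  injective f -> row_free W -> row_free (rowsub f W).
Proof.
move=> f_inj Wfree; apply: inj_row_free => v.
rewrite rowsubE mulmxA -[RHS](mul0mx _ W) => /(row_free_inj Wfree) /rowP v0.
apply/rowP => i; have := v0 (f i); rewrite !mxE (bigD1 i) //= !mxE eqxx mulr1.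
rewrite big1 ?addr0 // => l li; rewrite !mxE (inj_eq f_inj) (negPf li).
by rewrite mulr0.
Qed.

Lemma row_free_row_neq0 (F : fieldType) (m n : nat) (W : 'M[F]_(m, n)) (i : 'I_m) :
  row_free W -> row i W != 0.
Proof.
move=> Wfree; apply/eqP; rewrite rowE -[RHS](mul0mx _ W).
move=> /(row_free_inj Wfree) /rowP /(_ i).
by rewrite !mxE !eqxx => /eqP; rewrite oner_eq0.
Qed.

(** Row [i] times [b] equals row [j] times [a]. With [w] the bivector of two generators, it follows
    that they share at most one relator. *)
Lemma row_free_not_proportional (F : fieldType) (m n : nat) (W : 'M[F]_(m, n))
    (i j : 'I_m) (w : 'rV[F]_n) (a b : F) :
  row_free W -> row i W = a *: w -> row j W = b *: w -> i = j.
Proof.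
move=> Wfree Wi Wj; apply/eqP/negP => /negP ij.
have : (b *: (delta_mx 0 i : 'rV_m) - a *: delta_mx 0 j) *m W = 0.
  by rewrite mulmxBl -!scalemxAl -!rowE Wi Wj !scalerA mulrC subrr.
rewrite -[RHS](mul0mx _ W) => /(row_free_inj Wfree) /rowP /(_ i).
rewrite !mxE !eqxx (negPf ij) /= mulr1 mulr0 subr0 => b0.
by have := row_free_row_neq0 j Wfree; rewrite Wj b0 scale0r eqxx.
Qed.

(** Here [jh] relators on [h] generators survive, with vectors of rank [r]. The choice of [d] gives
    [(3 * d).+1 * k <= 4 * d * k <= N / 2], so at least half of the relators survive and
    [N <= 2 * r ^ 2]. From [N <= 16 * k * d] follows [r * N <= 48 * k ^ 2], and
    [4608 = 2 * 48 ^ 2]. *)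
Lemma quartic_bound (N k d h r jh : nat) :
  (0 < k)%N -> (8 * k <= N)%N -> d = (N %/ (8 * k))%N ->
  (N <= jh + (3 * d).+1 * k)%N -> (h <= k)%N -> (jh <= r * r)%N ->
  (d * r <= 3 * h)%N -> (N ^ 3 <= 4608 * k ^ 4)%N.
Proof.
move=> k0 kN dE Njh hk jhr drh.
have d0 : (0 < d)%N by rewrite dE divn_gt0 ?muln_gt0.
have dk : (8 * k * d <= N)%N by rewrite dE mulnC leq_trunc_div.
have Nd : (N <= 16 * k * d)%N.
  have : (N < d.+1 * (8 * k))%N by rewrite dE; apply: ltn_ceil; rewrite muln_gt0.
  by nia.
have N2 : (N <= 2 * (r * r))%N by nia.
have rN : (r * N <= 48 * (k * k))%N.
  apply: leq_trans (leq_mul (leqnn r) Nd) _.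
  have := leq_mul (leqnn (16 * k)%N) drh; have := leq_mul (leqnn (48 * k)%N) hk.
  by nia.
have := leq_mul (leq_mul (leqnn 2%N) rN) rN.
have := leq_mul N2 (leqnn (N * N)%N).
rewrite !expnS expn0 !muln1; lia.
Qed.

Lemma sparse_relations_bound (F : archiRealFieldType) (N k n : nat)
    (V : 'M[F]_(k, n)) (M : 'M[F]_(N, k)) (W : 'M[F]_(N, n * n)) :
  row_free W -> M *m V = 0 ->
  (forall j, 1 < #|[set g | M j g != 0%R]| <= 3)%N ->
  (forall j g h, g != h -> M j g != 0 -> M j h != 0 ->
     exists c, row j W = c *: mxvec (wedge (row g V) (row h V))) ->
  (8 * k <= N)%N -> (N ^ 3 <= 4608 * k ^ 4)%N.
Proof.
move=> Wfree MV supp WM; case: k => [|k'] in V M MV supp WM *.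
  case: N => [//|N] in W Wfree M MV supp WM *.
  have /andP[] := supp ord0; rewrite (_ : [set g | _] = set0) ?cards0 //.
  by apply/setP => -[].
set k := k'.+1 => kN; pose d := (N %/ (8 * k))%N.
pose S j := [set g | M j g != 0].
(* Minimal degree [(3 * d).+1] matches the strict bound on columns in [design_rank]. *)
have [H] := min_degree_subset S (3 * d).+1.
rewrite /= !card_ord; set JH := [set j | _] => -[JHge deg].
pose MH := \matrix_(j < #|JH|, g < #|H|) M (enum_val j) (enum_val g).
pose VH := rowsub (@enum_val _ (mem H)) V.
have SH (j : 'I_#|JH|) : S (enum_val j) \subset H.
  by have := enum_valP j; rewrite inE.
have MHsupp j : #|[set g | MH j g != 0]| = #|S (enum_val j)|.
  under eq_finset do rewrite mxE.
  rewrite (card_set_enum_val H (fun g => M (enum_val j) g != 0)).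
  apply: eq_card => g; rewrite !inE andbC; case: eqP => //= /eqP nz.
  by rewrite (subsetP (SH j)) // inE.
have MVH : MH *m VH = 0.
  apply/matrixP => j i; have /matrixP /(_ (enum_val j) i) := MV; rewrite !mxE => {2}<-.
  rewrite (bigID [in H]) /= [X in _ = _ + X]big1 ?addr0 => [|g gH]; last first.
    have := subsetP (SH j) g; rewrite inE (negPf gH) => nz.
    by have [->|/nz//] := eqVneq (M (enum_val j) g) 0; rewrite mul0r.
  by rewrite [RHS]big_enum_val; apply: eq_bigr => g _; rewrite !mxE.
apply: (@quartic_bound _ _ d #|H| (\rank VH) #|JH|) => //.
- by rewrite -[X in (_ <= X)%N]card_ord max_card.
(* The surviving bivectors are independent congruences by [VH], so there are at most [\rank VH]
   squared of them. *)
- have := row_free_rowsub (@enum_val_inj _ (mem JH)) Wfree.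
  rewrite /row_free => /eqP {1}<-; apply: rank_congruences => j.
  have /andP[/card_gt1P[g [h [gS hS gh]]] _] := supp (enum_val j).
  have gH := subsetP (SH j) _ gS; have hH := subsetP (SH j) _ hS.
  rewrite !inE in gS hS; have [c Wj] := WM _ _ _ gh gS hS.
  have VHrow x (xH : x \in H) : row x V = delta_mx 0 (enum_rank_in xH x) *m VH.
    by rewrite -rowE; apply/rowP => i; rewrite !mxE enum_rankK_in.
  exists (c *: wedge (delta_mx 0 (enum_rank_in gH g)) (delta_mx 0 (enum_rank_in hH h))).
  rewrite -scalemxAr -scalemxAl -wedge_mulmx -!VHrow linearZ /= -Wj.
  by apply/rowP => i; rewrite !mxE.
- apply: (design_rank _ _ _ MVH).
  + by move=> j; rewrite MHsupp; have /andP[/ltnW -> ->] := supp (enum_val j).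
  + move=> g; have := deg _ (enum_valP g); rewrite -card_set_enum_val.
    by congr (_ <= _)%N; apply: eq_card => j; rewrite !inE mxE.
  move=> g h i j gh; rewrite !mxE => ig ih jg jh; apply: enum_val_inj.
  have gh' : enum_val g != enum_val h by rewrite (inj_eq enum_val_inj).
  have [a Wi] := WM _ _ _ gh' ig ih; have [b Wj] := WM _ _ _ gh' jg jh.
  exact: row_free_not_proportional Wfree Wi Wj.
Qed.

(** * Bivectors and skew forms *)

Lemma wedgexx (R : pzRingType) (n : nat) (x : 'rV[R]_n) : wedge x x = 0.
Proof. exact: subrr. Qed.

Lemma wedgeC (R : pzRingType) (n : nat) (x y : 'rV[R]_n) : wedge y x = - wedge x y.
Proof. by rewrite /wedge opprB. Qed.

Lemma wedgeZ (R : comPzRingType) (n : nat) (a b : R) (x y : 'rV[R]_n) :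
  wedge (a *: x) (b *: y) = (a * b) *: wedge x y.
Proof.
rewrite /wedge !linearZ /= scalerN -?scalemxAl -?scalemxAr !scalerA scalerBr.
by rewrite (mulrC b).
Qed.

(** Any two cyclically consecutive syllables of a relator therefore give the same bivector. *)
Lemma wedge_cycle (R : pzRingType) (n : nat) (x y z : 'rV[R]_n) :
  x + y + z = 0 -> wedge y z = wedge x y.
Proof.
move=> /eqP; rewrite addrC addr_eq0 => /eqP ->.
rewrite /wedge mulmxN [(- _)^T]linearN /= [(x + y)^T]linearD /= mulNmx opprK.
by rewrite mulmxDr mulmxDl addrC opprD addrACA subrr addr0.
Qed.

Lemma skew_mulmx (R : comPzRingType) (n : nat) (B : 'M[R]_n) (x y : 'rV[R]_n) :
  B^T = - B -> y *m B *m x^T = - (x *m B *m y^T).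
Proof.
move=> BT; have tr1 (A : 'M[R]_1) : A^T = A.
  by apply/matrixP => i j; rewrite !ord1 mxE.
by rewrite -[LHS]tr1 !trmx_mul trmxK BT mulNmx mulmxN mulmxA.
Qed.

Lemma skew_mulmx_same (R : numDomainType) (n : nat) (B : 'M[R]_n) (x : 'rV[R]_n) :
  B^T = - B -> x *m B *m x^T = 0.
Proof.
move=> /(skew_mulmx x x) /matrixP e; apply/matrixP => i j.
by have /eqP := e i j; rewrite !mxE -addr_eq0 -mulr2n mulrn_eq0 => /eqP.
Qed.

Lemma wedge_dot_skew (R : comPzRingType) (n : nat) (B : 'M[R]_n) (x y : 'rV[R]_n) :
  B^T = - B ->
  mxvec (wedge x y) *m (mxvec B)^T = (x *m B *m y^T) *+ 2.
Proof.
move=> /(skew_mulmx x y) e.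
by rewrite /wedge linearB /= mulmxBl !mxvec_dotmul e opprK mulr2n.
Qed.

(* [W] separates the skew matrices with zero diagonal blocks. *)
Lemma rank_ge_of_skew_inj (F : fieldType) (m n1 n2 : nat)
    (W : 'M[F]_(m, (n1 + n2) * (n1 + n2))) :
  (forall B, B^T = - B -> W *m (mxvec B)^T = 0 -> B = 0) ->
  (n1 * n2 <= \rank W)%N.
Proof.
move=> Winj.
(* [G X] has [X] as its upper right block and zeros elsewhere; [L X] is its skew version, from which
   [LK] reads off [X]. *)
pose P : 'M[F]_(n1 + n2, n1) := col_mx 1%:M 0.
pose Q : 'M[F]_(n2, n1 + n2) := row_mx 0 1%:M.
pose G : 'M[F]_(n1, n2) -> 'M[F]_(n1 + n2) := mulmxr Q \o mulmx P.
pose L : 'M[F]_(n1, n2) -> 'M[F]_(n1 + n2) := G \- (trmx \o G).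
have PP : P^T *m P = 1%:M.
  by rewrite /P tr_col_mx mul_row_col trmx1 mul1mx trmx0 mul0mx addr0.
have QQ : Q *m Q^T = 1%:M.
  by rewrite /Q tr_row_mx mul_row_col trmx0 mul0mx trmx1 mul1mx add0r.
have QP : Q *m P = 0.
  by rewrite /P /Q mul_row_col mul0mx mulmx0 addr0.
have LX X : L X = P *m X *m Q - (P *m X *m Q)^T by [].
have LK X : P^T *m L X *m Q^T = X.
  rewrite LX mulmxBr mulmxBl !mulmxA PP mul1mx -mulmxA QQ mulmx1.
  rewrite !trmx_mul !mulmxA -trmx_mul QP trmx0 !mul0mx.
  by rewrite oppr0 addr0.
suff : row_free (lin_mx L *m W^T).
  rewrite /row_free => /eqP <-; rewrite -[leqRHS]mxrank_tr.
  exact: mxrankM_maxr.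
apply: inj_row_free => v; rewrite mulmxA -(vec_mxK v) mul_vec_lin => vW.
have : L (vec_mx v) = 0.
  apply: Winj; first by rewrite LX linearB /= trmxK opprB.
  by rewrite -[LHS]trmxK trmx_mul trmxK vW trmx0.
by move=> L0; rewrite -(LK (vec_mx v)) L0 mulmx0 mul0mx linear0.
Qed.

(** * The homomorphism to a Heisenberg-type extension *)

Definition letter_vec (R : pzRingType) (k n : nat) (V : 'M[R]_(k, n)) (x : letter k) :
  'rV[R]_n := if x.2 then - row x.1 V else row x.1 V.

Definition word_vec (R : pzRingType) (k n : nat) (V : 'M[R]_(k, n)) (w : word k) :
  'rV[R]_n := \sum_(x <- w) letter_vec V x.

(* Central coordinate of the image of [w] in the Heisenberg-type extension with
   product [(u, s) (v, t) = (u + v, s + t + u B v^T)]. *)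
Fixpoint twist (R : pzRingType) (k n : nat) (V : 'M[R]_(k, n)) (B : 'M[R]_n)
    (w : word k) : 'M[R]_1 :=
  if w is x :: w' then letter_vec V x *m B *m (word_vec V w')^T + twist V B w'
  else 0.

Definition syllable_vec (R : pzRingType) (k n : nat) (V : 'M[R]_(k, n))
    (p : 'I_k * int) : 'rV[R]_n := p.2%:~R *: row p.1 V.

(** When the syllable vectors sum to zero, any two of three give this bivector up to sign, and two
    alone are opposite, with zero bivector. *)
Definition relator_wedge (R : pzRingType) (k n : nat) (V : 'M[R]_(k, n))
    (r : relator k) : 'M[R]_n :=
  if r is [:: p; q; _] then wedge (syllable_vec V p) (syllable_vec V q) else 0.

Lemma word_vec_cat (R : pzRingType) (k n : nat) (V : 'M[R]_(k, n)) (u v : word k) :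
  word_vec V (u ++ v) = word_vec V u + word_vec V v.
Proof. exact: big_cat. Qed.

Lemma twist_cat (R : pzRingType) (k n : nat) (V : 'M[R]_(k, n)) (B : 'M[R]_n)
    (u v : word k) :
  twist V B (u ++ v) =
  twist V B u + twist V B v + word_vec V u *m B *m (word_vec V v)^T.
Proof.
elim: u => [|x u IH] /=.
  by rewrite /word_vec big_nil !mul0mx add0r addr0.
rewrite IH word_vec_cat [word_vec V (x :: u)]big_cons -/(word_vec V u).
rewrite [(_ + _)^T]linearD /= mulmxDr !mulmxDl -!addrA; congr (_ + _).
by rewrite [LHS]addrCA; congr (_ + _); rewrite [LHS]addrCA.
Qed.

Lemma letter_vec_inv (R : pzRingType) (k n : nat) (V : 'M[R]_(k, n)) (x : letter k) :
  letter_vec V (inv_letter x) = - letter_vec V x.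
Proof. by case: x => g []; rewrite /letter_vec /= ?opprK. Qed.

Lemma word_vec_nseq (R : pzRingType) (k n : nat) (V : 'M[R]_(k, n)) (m : nat)
    (x : letter k) :
  word_vec V (nseq m x) = letter_vec V x *+ m.
Proof.
elim: m => [|m IH]; first by rewrite /word_vec big_nil.
by rewrite [LHS]big_cons -/(word_vec V (nseq m x)) IH mulrS.
Qed.

Lemma word_vec_syllable (R : pzRingType) (k n : nat) (V : 'M[R]_(k, n))
    (p : 'I_k * int) :
  word_vec V (nseq `|p.2|%N (p.1, p.2 < 0)) = syllable_vec V p.
Proof.
rewrite word_vec_nseq /syllable_vec /letter_vec.
case: p => g [a|a] /=; first by rewrite -scaler_nat.
by rewrite NegzE mulrNz scaleNr mulNrn -scaler_nat.
Qed.

Lemma twist_nseq (R : numDomainType) (k n : nat) (V : 'M[R]_(k, n)) (B : 'M[R]_n)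
    (m : nat) (x : letter k) :
  B^T = - B -> twist V B (nseq m x) = 0.
Proof.
move=> skewB; elim: m => //= m ->; rewrite addr0 word_vec_nseq.
by rewrite -scaler_nat linearZ /= -scalemxAr skew_mulmx_same ?scaler0.
Qed.

Lemma word_vec_expand (R : pzRingType) (k n : nat) (V : 'M[R]_(k, n)) (r : relator k) :
  word_vec V (expand r) = \sum_(p <- r) syllable_vec V p.
Proof.
elim: r => [|p r IH]; first by rewrite /word_vec !big_nil.
by rewrite big_cons -IH -word_vec_syllable -word_vec_cat.
Qed.

(** A power of one letter has no twist, so syllables [p], [q], [r] have twist
    [B(p, q + r) + B(q, r)]. As [p + q + r = 0], this is [B(p, q)], half the pairing of [B] with the
    bivector. *)
Lemma twist_expand (R : numFieldType) (k n : nat) (V : 'M[R]_(k, n)) (B : 'M[R]_n)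
    (r : relator k) :
  B^T = - B -> (size r <= 3)%N -> word_vec V (expand r) = 0 ->
  mxvec (relator_wedge V r) *m (mxvec B)^T = 0 -> twist V B (expand r) = 0.
Proof.
move=> skewB; rewrite word_vec_expand.
have twist_cons (p : 'I_k * int) (s : relator k) : twist V B (expand (p :: s)) =
    twist V B (expand s) + syllable_vec V p *m B *m (\sum_(q <- s) syllable_vec V q)^T.
  by rewrite /expand /= twist_cat twist_nseq // add0r word_vec_syllable -word_vec_expand.
have same x := skew_mulmx_same x skewB.
case: r => [//|p [|q [|r [|//]]]] _; rewrite !twist_cons !big_cons !big_nil
  /= ?addr0 ?trmx0 ?mulmx0 ?add0r //.
  by move=> /eqP; rewrite addrC addr_eq0 => /eqP -> _; rewrite linearN mulmxN same oppr0.
move=> /eqP; rewrite addr_eq0 => /eqP pE; rewrite wedge_dot_skew //.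
move/eqP; rewrite -scaler_nat scaler_eq0 pnatr_eq0 /= => /eqP pq.
rewrite pE mulNmx mulNmx same oppr0 addr0.
have rE : syllable_vec V r = - (syllable_vec V p + syllable_vec V q).
  by rewrite pE opprD opprK addrAC subrr add0r.
rewrite rE [(- _)^T]linearN /= [(_ + _)^T]linearD /= mulmxN mulmxDr same addr0.
by rewrite (skew_mulmx (syllable_vec V p)) // pq !oppr0.
Qed.

(** The homomorphism to the extension kills every relator, so it descends to the presented group. *)
Lemma wequiv_twist (R : numDomainType) (k n : nat) (V : 'M[R]_(k, n)) (B : 'M[R]_n)
    (Rel : seq (relator k)) (u v : word k) :
  B^T = - B ->
  (forall r, r \in Rel -> word_vec V (expand r) = 0 /\ twist V B (expand r) = 0) ->
  wequiv Rel u v -> word_vec V u = word_vec V v /\ twist V B u = twist V B v.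
Proof.
move=> skewB Rel0.
have drop (a b c : word k) : word_vec V b = 0 -> twist V B b = 0 ->
    word_vec V (a ++ b ++ c) = word_vec V (a ++ c) /\
    twist V B (a ++ b ++ c) = twist V B (a ++ c).
  move=> b0 tb0; rewrite !word_vec_cat !twist_cat !word_vec_cat b0 tb0.
  by rewrite !add0r mul0mx !mul0mx addr0.
elim=> {u v} [//|u v _ [-> ->] //|u v w _ [-> ->] _ [-> ->] //|u v x|u v r /Rel0[]].
  apply: drop.
    by rewrite /word_vec !big_cons big_nil letter_vec_inv addr0 subrr.
  rewrite /= /word_vec !big_cons !big_nil letter_vec_inv !addr0 trmx0 mulmx0 addr0.
  by rewrite linearN mulmxN skew_mulmx_same ?oppr0.
exact: drop.
Qed.

Lemma presents_Zn_rat (k n : nat) (Rel : seq (relator k)) :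
  three_presentation Rel -> presents_Zn Rel n ->
  exists V : 'M[rat]_(k, n),
    [/\ row_full V,
        forall r, r \in Rel -> \sum_(p <- r) syllable_vec V p = 0
      & forall B : 'M[rat]_n, B^T = - B ->
          (forall r, r \in Rel -> mxvec (relator_wedge V r) *m (mxvec B)^T = 0) ->
          B = 0].
Proof.
move=> /allP three [f [surj ker]].
pose V : 'M[rat]_(k, n) := \matrix_g map_mx intr (f g).
have wordE w : word_vec V w = map_mx intr (eval_word f w).
  rewrite /word_vec /eval_word raddf_sum; apply: eq_bigr => -[g b] _.
  by rewrite /letter_vec rowK; case: b => //=; rewrite raddfN.
have relE r : r \in Rel -> word_vec V (expand r) = 0.
  move=> rR; rewrite wordE (proj2 (ker (expand r))) ?raddf0 //.
  by have := we_rel [::] [::] rR; rewrite /= cats0.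
have Vfull : row_full V.
  rewrite -sub1mx; apply/row_subP => i; have [w wE] := surj (row i 1%:M).
  have -> : row i 1%:M = word_vec V w by rewrite wordE wE map_row map_mx1.
  apply: summx_sub => -[g b] _; rewrite /letter_vec.
  by case: b; rewrite ?eqmx_opp row_sub.
exists V; split=> // [r /relE|B skewB Brel]; first by rewrite word_vec_expand.
have twist0 r : r \in Rel -> word_vec V (expand r) = 0 /\ twist V B (expand r) = 0.
  move=> rR; split; first exact: relE.
  by apply: twist_expand => //; [apply: three | apply: relE | apply: Brel].
(* The commutator of two generators is trivial in the presented group, and its twist is twice the
   value of [B] on their vectors. *)
have VBV : V *m B *m V^T = 0.
  apply/matrixP => g h.
  pose w : word k := [:: (g, false); (h, false); (g, true); (h, true)].
  have w0 : eval_word f w = 0.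
    by rewrite /eval_word !big_cons big_nil addr0 /= addrA -opprD subrr.
  have [_] := wequiv_twist skewB twist0 (proj1 (ker w) w0).
  rewrite /= /word_vec !big_cons !big_nil /letter_vec /= !addr0 trmx0 mulmx0 addr0.
  set x := row g V; set y := row h V.
  have same z := skew_mulmx_same z skewB.
  have -> : y + (- x - y) = - x by rewrite addrC addrNK.
  have trN (z : 'rV[rat]_n) : (- z)^T = - z^T by exact: linearN.
  have -> : (- x - y)^T = - x^T - y^T by rewrite [LHS]linearD /= !trN.
  rewrite !trN mulmxDr !mulmxN !mulNmx !same opprK oppr0 add0r addr0.
  rewrite (skew_mulmx x y skewB) opprK -mulr2n -scaler_nat => /eqP.
  rewrite scaler_eq0 pnatr_eq0 /= => /eqP xy0.
  have /matrixP /(_ 0 0) := xy0; rewrite /x /y -row_mul tr_row !mxE => xy00.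
  by rewrite -[RHS]xy00; apply: eq_bigr => l _; rewrite !mxE.
have [L LV] := row_fullP Vfull.
have : L *m (V *m B *m V^T) *m L^T = 0 by rewrite VBV mulmx0 mul0mx.
by rewrite !mulmxA LV mul1mx -mulmxA -trmx_mul LV trmx1 mulmx1.
Qed.

(** * Relators as sparse relations, and the integer bound *)

Definition relator_coef (R : pzRingType) (k : nat) (r : relator k) : 'rV[R]_k :=
  \sum_(p <- r) p.2%:~R *: delta_mx 0 p.1.

Lemma mul_relator_coef (R : pzRingType) (k n : nat) (V : 'M[R]_(k, n)) (r : relator k) :
  relator_coef R r *m V = \sum_(p <- r) syllable_vec V p.
Proof.
by rewrite mulmx_suml; apply: eq_bigr => p _; rewrite -scalemxAl -rowE.
Qed.

(** By [wedge_cycle] the bivector is the wedge of each cyclically consecutive pair of syllables.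
    Being nonzero, it forces the three generators to be distinct, so no coefficients merge. *)
Lemma relator_coef_support (F : fieldType) (k n : nat) (V : 'M[F]_(k, n))
    (r : relator k) :
  \sum_(p <- r) syllable_vec V p = 0 -> relator_wedge V r != 0 ->
  (1 < #|[set g | relator_coef F r 0%R g != 0%R]| <= 3)%N /\
  forall g h, g != h -> relator_coef F r 0 g != 0 -> relator_coef F r 0 h != 0 ->
    exists c, relator_wedge V r = c *: wedge (row g V) (row h V).
Proof.
case: r => [|[g1 a1] [|[g2 a2] [|[g3 a3] [|p r]]]]; rewrite ?eqxx //= => sum0.
have coefE g : relator_coef F [:: (g1, a1); (g2, a2); (g3, a3)] 0 g =
    a1%:~R *+ (g1 == g) + a2%:~R *+ (g2 == g) + a3%:~R *+ (g3 == g).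
  rewrite /relator_coef !big_cons big_nil addr0 !mxE /= !(eq_sym g) -!addrA.
  by rewrite !mulr_natr.
rewrite !big_cons big_nil addr0 addrA in sum0.
move: (wedge_cycle sum0); rewrite addrC addrA in sum0; move: (wedge_cycle sum0).
rewrite /syllable_vec /= !wedgeZ; set w := _ *: wedge (row g1 V) _ => w31 w23 w0.
have nz b (x y : 'rV[F]_n) : w = b *: wedge x y -> b != 0 /\ wedge x y != 0.
  by move=> e; move: w0; rewrite e scaler_eq0 negb_or => /andP[].
have [] := nz _ _ _ (erefl w); rewrite mulf_eq0 negb_or => /andP[a10 a20] w12_0.
have [_ w23_0] := nz _ _ _ (esym w23); have [_ w31_0] := nz _ _ _ w31.
have neq g h : wedge (row g V) (row h V) != 0 -> (g == h) = false.
  by apply: contraNF => /eqP ->; rewrite wedgexx.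
have n12 := neq _ _ w12_0; have n23 := neq _ _ w23_0; have n31 := neq _ _ w31_0.
have n13 : (g1 == g3) = false by rewrite eq_sym.
have n21 : (g2 == g1) = false by rewrite eq_sym.
have supp g : relator_coef F [:: (g1, a1); (g2, a2); (g3, a3)] 0 g != 0 ->
    g \in [:: g1; g2; g3].
  rewrite coefE !inE ![g == _]eq_sym.
  case: (g1 == g) => //; case: (g2 == g) => //; case: (g3 == g) => //.
  by rewrite !mulr0n !addr0 eqxx.
split.
  apply/andP; split.
    apply/card_gt1P; exists g1, g2; rewrite !inE !coefE !eqxx n12 n21 n31.
    by rewrite [g3 == g2]eq_sym n23 /= ?addr0 ?add0r a10 a20.
  apply: leq_trans (card_size [:: g1; g2; g3]); apply: subset_leq_card.
  by apply/subsetP => g; rewrite inE => /supp.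
move=> g h gh /supp gs /supp hs; move: gs hs gh; rewrite !inE.
by move=> /or3P[] /eqP-> /or3P[] /eqP->; rewrite ?eqxx // => _;
  [ exists (a1%:~R * a2%:~R)
  | exists (- (a3%:~R * a1%:~R)); rewrite wedgeC scalerN scaleNr opprK -w31
  | exists (- (a1%:~R * a2%:~R)); rewrite wedgeC scalerN scaleNr opprK
  | exists (a2%:~R * a3%:~R); rewrite w23
  | exists (a3%:~R * a1%:~R); rewrite -w31
  | exists (- (a2%:~R * a3%:~R)); rewrite wedgeC scalerN scaleNr opprK w23 ].
Qed.

Lemma sqr_le_rank_of_skew_inj (F : fieldType) (m n : nat) (W : 'M[F]_(m, n * n)) :
  (1 < n)%N -> (forall B, B^T = - B -> W *m (mxvec B)^T = 0 -> B = 0) ->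
  (n ^ 2 <= 8 * \rank W)%N.
Proof.
(* Two blocks of nearly equal size give at least [(n ^ 2 - 1) / 4], which is at least [n ^ 2 / 8]
   for [n >= 2]. *)
move=> n1 Winj; apply: leq_trans (_ : 8 * (n./2 * uphalf n) <= _)%N.
  by have := odd_double_half n; rewrite uphalf_half; case: odd => /=; nia.
rewrite leq_mul2l /=; have : n = (n./2 + uphalf n)%N.
  by rewrite -[LHS]odd_double_half uphalf_half; lia.
move: (n./2) (uphalf n) => a b en; move: W Winj; rewrite {}en => W.
exact: rank_ge_of_skew_inj.
Qed.

Lemma three_presentation_bound (k n : nat) (Rel : seq (relator k)) :
  (1 <= n)%N -> three_presentation Rel -> presents_Zn Rel n ->
  (n ^ 3 <= 1600 * k ^ 2)%N.
Proof.
move=> n0 three pres; have [V [Vfull Vrel Vskew]] := presents_Zn_rat three pres.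
have nk : (n <= k)%N by move: Vfull; rewrite /row_full => /eqP <-; apply: rank_leq_row.
pose m := size Rel; pose rel (j : 'I_m) := nth [::] Rel j.
have relP j : rel j \in Rel by apply: mem_nth.
pose W : 'M[rat]_(m, n * n) := \matrix_j mxvec (relator_wedge V (rel j)).
have Wskew B : B^T = - B -> W *m (mxvec B)^T = 0 -> B = 0.
  move=> skewB WB; apply: Vskew => // r /(nthP [::]) [j jm <-].
  have := congr1 (row (Ordinal jm)) WB.
  by rewrite row_mul rowK row0.
have rankW : (n <= 1)%N \/ (n ^ 2 <= 8 * \rank W)%N.
  case: (leqP n 1) => [|n1]; [by left | right].
  exact: sqr_le_rank_of_skew_inj.
(* For [n >= 2], the first case gives [n ^ 6 <= 8 ^ 3 * 4608 * k ^ 4 = (1536 * k ^ 2) ^ 2], and the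
   second gives [n ^ 2 < 64 * k], which suffices because [n <= k]. *)
suff : (\rank W ^ 3 <= 4608 * k ^ 4)%N \/ (\rank W < 8 * k)%N.
  move: (\rank W) rankW => N [n1|nN] [N3|Nk].
  - by rewrite (_ : n = 1)%N; nia.
  - by rewrite (_ : n = 1)%N; nia.
  - rewrite -(@leq_exp2r _ _ 2) //.
    have := leq_mul (leq_mul nN nN) nN; move: N3; rewrite !expnS !expn0 !muln1.
    by nia.
  - by rewrite !expnS !expn0 !muln1 in nN *; nia.
case: (leqP (8 * k) (\rank W)) => [kN|]; last by right.
(* Keep a maximal family of relators with independent bivectors. *)
left; pose f := maxrankfun W.
have Wfree : row_free (rowsub f W) := maxrowsub_free W.
pose M : 'M[rat]_(\rank W, k) := \matrix_j relator_coef _ (rel (f j)).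
have supp j : relator_wedge V (rel (f j)) != 0.
  have := row_free_row_neq0 j Wfree; apply: contraNneq => w0.
  by apply/eqP/rowP => i; rewrite !mxE w0 linear0 mxE.
have key j := relator_coef_support (Vrel _ (relP (f j))) (supp j).
apply: (sparse_relations_bound Wfree (V := V) (M := M)) => //.
- by apply/row_matrixP => j; rewrite row_mul rowK mul_relator_coef row0 Vrel.
- by move=> j; have [? _] := key j; under eq_finset do rewrite mxE.
move=> j g h gh; rewrite !mxE => Mg Mh; have [_ /(_ g h gh Mg Mh) [c cE]] := key j.
exists c; by rewrite -linearZ -cE; apply/rowP => i; rewrite !mxE.
Qed.

(* The bound with a real constant *)
Local Close Scope ring_scope.

From Stdlib Require Import Reals Lra.

Theorem mainTheorem17 :
  exists c : R, Rlt 0 c /\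
    forall (n k : nat) (Rel : seq (relator k)),
      (1 <= n)%nat -> three_presentation Rel -> presents_Zn Rel n ->
      Rle (Rmult c (Rmult (INR n) (sqrt (INR n)))) (INR k).
Proof.
(* The constant comes from the square root of [n ^ 3 <= 1600 * k ^ 2], where [1600 = 40 ^ 2]. *)
exists (/ 40)%R; split=> [|n k Rel n0 three pres]; first by Lra.lra.
have := three_presentation_bound n0 three pres.
rewrite !expnS !expn0 !muln1 => /ssrnat.leP /le_INR; rewrite !mult_INR.
have -> : INR 1600 = 1600%R by rewrite INR_IZR_INZ.
have s2 := sqrt_sqrt _ (pos_INR n); have s0 := sqrt_pos (INR n).
have k0 := pos_INR k; have nn0 := pos_INR n.
set s := sqrt _ in s2 s0 *; set x := INR n in s2 nn0 *; set y := INR k in k0 * => le.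
have : (x * s <= 40 * y)%R; last by Lra.lra.
by apply: Rsqr_incr_0_var; rewrite /Rsqr; Lra.nra.
Qed.
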